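(* Let $\nu\ge-\frac12$ and $\mu<\frac12\left(\nu+\frac12\right)$ be real numbers. Then for all $x>0$ and $\tau>0$, $$|K_{\mu+i\tau}(x)|\le 2^{\nu-\mu-1}\,c_\nu\,\frac{\Gamma\left(\frac{\nu+3/2}{2}\right)\Gamma\left(\frac{\nu-2\mu+1/2}{2}\right)}{\Gamma(\nu-\mu+1)}\,\bigl|\Gamma(\nu-\mu+1+i\tau)\bigr|\,x^{\mu-\nu-1/2},$$ where $c_\nu=\sup_{t\ge0}\sqrt t\,|J_\nu(t)|$.
   Context: $K_z(x)=\int_0^\infty e^{-x\cosh t}\cosh(zt)\,dt$ ($x>0$, $z\in\mathbb{C}$) is the Macdonald function (modified Bessel function of the second kind); $J_\nu$ is the Bessel function of the first kind; $\Gamma$ is the Euler gamma function. For $\nu=-1/2$ the quantity $\sqrt t\,|J_\nu(t)|$ at $t=0$ is understood as its limit as $t\to0+$. *)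

(* Defs.v *)
From HB Require Import structures.
From mathcomp Require Import all_boot all_order all_algebra.
From mathcomp Require Import all_classical all_reals all_analysis.
From mathcomp Require Import complex.

Set Implicit Arguments.
Unset Strict Implicit.
Unset Printing Implicit Defensive.

Import Order.TTheory GRing.Theory Num.Theory.
Import numFieldNormedType.Exports.

Local Open Scope classical_set_scope.
Local Open Scope complex_scope.
Local Open Scope ring_scope.

(* R[i] is a record {Re; Im}; [complex_norm] is its modulus, valued in R
   (the generic `|z| is valued in R[i]). *)
Notation complex_norm := ComplexField.Normc.normc.

Definition cexp (R : realType) (z : R[i]) : R[i] :=
  (expR (complex.Re z) * cos (complex.Im z)) +i*
  (expR (complex.Re z) * sin (complex.Im z)).

Definition cosh (R : realType) (t : R) : R := (expR t + expR (- t)) / 2.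

Definition ccosh (R : realType) (z : R[i]) : R[i] :=
  (cexp z + cexp (- z)) / 2.

(* Lebesgue integral of a complex-valued function of a real variable, real and
   imaginary parts separately. *)
Definition cintegral (R : realType) (D : set R) (f : R -> R[i]) : R[i] :=
  (\int[lebesgue_measure]_(t in D) complex.Re (f t)) +i*
  (\int[lebesgue_measure]_(t in D) complex.Im (f t)).

Definition macdonaldK (R : realType) (z : R[i]) (x : R) : R[i] :=
  cintegral `[0, +oo[
    (fun t => (expR (- x * cosh t))%:C * ccosh (z * t%:C)).

(* Euler's integrals, so meaningful for 0 < a and 0 < Re z only: all the
   arguments used here are of that kind.  [cGamma_real] relates the two. *)
Definition Gamma (R : realType) (a : R) : R :=
  \int[lebesgue_measure]_(s in `]0, +oo[) (s `^ (a - 1) * expR (- s)).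

Definition cGamma (R : realType) (z : R[i]) : R[i] :=
  cintegral `]0, +oo[
    (fun s => cexp ((z - 1) * (ln s)%:C) * (expR (- s))%:C).

Lemma cGamma_real (R : realType) (a : R) : cGamma a%:C = (Gamma a)%:C.
Proof.
rewrite /cGamma /cintegral /Gamma; congr (_ +i* _).
- apply: eq_Rintegral => s; rewrite inE /= in_itv/= andbT => s0.
  rewrite /cexp /powR gt_eqF //=.
  by rewrite !(mulr0, mul0r, subr0, addr0, add0r, oppr0) cos0 mulr1.
- under eq_Rintegral => s _.
    rewrite /cexp /= !(mulr0, mul0r, subr0, addr0, add0r, oppr0) sin0.
    rewrite mulr0 mul0r; over.
  by rewrite /Rintegral integral0.
Qed.

(* The series in powers of t / 2, for 0 < t and -1 < nu. *)
Definition besselJ (R : realType) (nu t : R) : R :=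
  limn (series (fun k : nat =>
    (-1) ^+ k / (k`!%:R * Gamma (nu + k%:R + 1)) *
    (t / 2) `^ (nu + 2 * k%:R))).

(* sqrt t * |J_nu t|.  For nu = - 1 / 2 its value at t = 0 is the right limit;
   for - 1 / 2 < nu its value at t = 0 is 0, which is again the right limit. *)
Definition sqrt_besselJ (R : realType) (nu t : R) : R :=
  if (t == 0) && (nu == - (1 / 2)) then
    lim ((Num.sqrt s * `|besselJ nu s|) @[s --> 0^'+])
  else Num.sqrt t * `|besselJ nu t|.

(* [sup] is the supremum of a bounded set of reals; it is 0 when the set is
   unbounded, which does not happen for nu >= - 1 / 2. *)
Definition bessel_sup (R : realType) (nu : R) : R :=
  sup [set sqrt_besselJ nu t | t in `[0, +oo[].

(* Main.v *)
(** Gegenbauer's formula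
      K_z(x) = 2^(nu-z) Gamma(nu-z+1) x^(z-nu)
               int_0^oo J_nu(x t) t^(nu+1) (t^2+1)^(z-nu-1) dt
    gives the bound at once, since |J_nu(x t)| <= c_nu (x t)^(-1/2) leaves a beta
    integral. It follows by Fubini from Weber's integral
      int_0^oo J_nu(x t) t^(nu+1) e^(-s t^2) dt
        = x^nu (2 s)^(-nu-1) e^(-x^2/(4 s)),
    integrated against s^(nu-z) e^(-s) ds. The variables s = e^u and t^2 = e^w are
    used throughout, so that all integrals run over the real line and scaling
    becomes translation. A complex modulus is estimated through its components
    cos phi Re + sin phi Im, which keeps every integrand real.

    The constant c_nu is finite because u(t) = sqrt t J_nu(t) solves
    u'' = - (1 - (nu^2 - 1/4) / t^2) u, whose energy stays bounded as t grows. *)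

Require Import Defs.
From HB Require Import structures.
From mathcomp Require Import all_boot all_order all_algebra.
From mathcomp Require Import all_classical all_reals all_analysis.
From mathcomp Require Import measurable_realfun complex.
From mathcomp Require Import ring lra.

Set Implicit Arguments.
Unset Strict Implicit.
Unset Printing Implicit Defensive.

Import Order.TTheory GRing.Theory Num.Theory.
Import numFieldNormedType.Exports.

Local Open Scope classical_set_scope.
Local Open Scope complex_scope.
Local Open Scope ring_scope.

(** * Integration over the real line *)

Section continuity_rules.
Context {R : realType}.
Implicit Types f g : R -> R.

Lemma continuous_idR : continuous (fun u : R => u).
Proof. by move=> u; exact: cvg_id. Qed.

Lemma continuous_cstR (c : R) : continuous (fun _ : R => c).
Proof. by move=> u; exact: cvg_cst. Qed.

Lemma continuous_addR f g :
  continuous f -> continuous g -> continuous (fun u => f u + g u).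
Proof. by move=> cf cg u; apply: cvgD; [exact: cf|exact: cg]. Qed.

Lemma continuous_oppR f : continuous f -> continuous (fun u => - f u).
Proof. by move=> cf u; apply: cvgN; exact: cf. Qed.

Lemma continuous_mulR f g :
  continuous f -> continuous g -> continuous (fun u => f u * g u).
Proof. by move=> cf cg u; apply: cvgM; [exact: cf|exact: cg]. Qed.

Lemma continuous_compR f g :
  continuous f -> continuous g -> continuous (fun u => f (g u)).
Proof. by move=> cf cg u; apply: (@continuous_comp _ _ _ g f); [exact: cg|exact: cf]. Qed.

Lemma continuous_normR f : continuous f -> continuous (fun u => `|f u|).
Proof. by move=> cf; apply: continuous_compR => //; exact: (@norm_continuous _ R^o). Qed.

End continuity_rules.

(** Continuity is read off the syntax of the function. A function outside this list is accepted when
    its continuity is in the context, which is why facts such as [continuous_cosh] are introduced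
    before the calls. *)
Ltac continuity := repeat
  lazymatch goal with
  | H : continuous ?f |- continuous ?f => exact H
  | H : continuous ?f |- continuous (fun u => ?f (@?g u)) => apply (@continuous_compR _ f g); [exact H|]
  | |- continuous (fun _ => ?c) => exact (@continuous_cstR _ c)
  | |- continuous (fun u => u) => exact (@continuous_idR _)
  | |- continuous (fun u => GRing.add (@?f u) (@?g u)) => apply (@continuous_addR _ f g)
  | |- continuous (fun u => GRing.opp (@?f u)) => apply (@continuous_oppR _ f)
  | |- continuous (fun u => GRing.mul (@?f u) (@?g u)) => apply (@continuous_mulR _ f g)
  | |- continuous (fun u => expR (@?f u)) => apply (@continuous_compR _ (@expR _) f); [exact: continuous_expR|]
  | |- continuous (fun u => cos (@?f u)) => apply (@continuous_compR _ (@cos _) f); [exact: continuous_cos|]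
  | |- continuous (fun u => sin (@?f u)) => apply (@continuous_compR _ (@sin _) f); [exact: continuous_sin|]
  | |- continuous (fun u => Num.norm (@?f u)) => apply (@continuous_normR _ f)
  end.

(** * Translation, logarithmic substitution and folding of integrals over the line *)

Section integral_real_line.
Context {R : realType}.
Notation mu := (@lebesgue_measure R).
Implicit Types (f g : R -> R) (c : R).

Lemma continuous_maxr0 f : continuous f -> continuous (fun u => Num.max (f u) 0).
Proof.
by move=> cf u; apply: (@continuous_max R _ f (cst 0) u); [exact: cf|exact: cvg_cst].
Qed.

Lemma continuous_measurable_EFin (D : set R) f : measurable D -> continuous f ->
  measurable_fun D (fun u => (f u)%:E).
Proof.
move=> mD cf; apply/measurable_EFinP/measurable_funTS.
exact: continuous_measurable_fun.
Qed.

Lemma continuous_compN f : continuous f -> continuous (fun u => f (- u)).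
Proof.
move=> cf u; apply: (@continuous_comp _ _ _ (fun v : R => - v) f).
  exact: opp_continuous.
exact: cf.
Qed.

(** The integral is the difference of the integrals of the positive and negative parts, so an
    identity known for nonnegative integrands extends to signed ones without an integrability
    assumption. *)
Lemma eq_integral_maxr (D E : set R) (h1 h2 : R -> R) :
  (\int[mu]_(u in D) (Num.max (h1 u) 0)%:E =
   \int[mu]_(u in E) (Num.max (h2 u) 0)%:E)%E ->
  (\int[mu]_(u in D) (Num.max (- h1 u) 0)%:E =
   \int[mu]_(u in E) (Num.max (- h2 u) 0)%:E)%E ->
  (\int[mu]_(u in D) (h1 u)%:E = \int[mu]_(u in E) (h2 u)%:E)%E.
Proof.
move=> hp hn; rewrite [LHS]integralE [RHS]integralE; congr (_ - _)%E.
- transitivity (\int[mu]_(u in D) (Num.max (h1 u) 0)%:E)%E; last rewrite hp.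
    by apply: eq_integral => u _; rewrite funeposE EFin_max.
  by apply: eq_integral => u _; rewrite funeposE EFin_max.
- transitivity (\int[mu]_(u in D) (Num.max (- h1 u) 0)%:E)%E; last rewrite hn.
    by apply: eq_integral => u _; rewrite funenegE EFin_max.
  by apply: eq_integral => u _; rewrite funenegE EFin_max.
Qed.

Let ge0_integral_shift f c : continuous f -> (forall u, 0 <= f u) ->
  (\int[mu]_u (f (u + c))%:E = \int[mu]_u (f u)%:E)%E.
Proof.
move=> cf f0; have dF (x : R) : is_derive x (1 : R) (fun u : R => u + c) 1.
  by apply: is_derive_eq; rewrite addr0.
have dE : derive1 (fun u : R => u + c) = cst 1.
  by apply/funext => x; rewrite derive1E derive_val.
rewrite [RHS](@increasing_ge0_integration_by_substitutionT R (fun u => u + c)) ?dE//.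
- by apply: eq_integral => u _; rewrite !fctE/= mulr1.
- by move=> x y; rewrite ltrD2r.
- by move=> ?; exact: cvg_cst.
- exact: is_cvg_cst.
- exact: is_cvg_cst.
- apply/cvgrNyPle => A; near=> x.
  by rewrite -lerBrDr; near: x; exact: nbhs_ninfty_le (num_real _).
- apply/cvgryPge => A; near=> x.
  by rewrite -lerBlDr; near: x; exact: nbhs_pinfty_ge (num_real _).
Unshelve. all: by end_near. Qed.

Lemma integral_shift f c : continuous f ->
  (\int[mu]_u (f (u + c))%:E = \int[mu]_u (f u)%:E)%E.
Proof.
move=> cf; apply: eq_integral_maxr.
- rewrite -(ge0_integral_shift c (continuous_maxr0 cf))// => u.
  by rewrite le_max lexx orbT.
- have cNf : continuous (fun u => - f u) by move=> u; apply: cvgN; exact: cf.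
  rewrite -(ge0_integral_shift c (continuous_maxr0 cNf))// => u.
  by rewrite le_max lexx orbT.
Qed.

Let bigcup_itvNy : \bigcup_n `[- n%:R, +oo[%classic = [set: R].
Proof.
apply/seteqP; split=> // x _; have [n nx] : exists n : nat, - x <= n%:R.
  by exists (Num.truncn `|- x|).+1; rewrite (le_trans (ler_norm _))// ltW// truncnS_gt.
by exists n => //=; rewrite in_itv/= andbT lerNl.
Qed.

Let bigcup_itv0y : \bigcup_n `[expR (- n%:R) : R, +oo[%classic = `]0, +oo[%classic.
Proof.
apply/seteqP; split=> x /=.
  move=> [n _] /=; rewrite !in_itv/= !andbT; apply: lt_le_trans; exact: expR_gt0.
rewrite in_itv/= andbT => x0.
have [n nx] : exists n : nat, - ln x <= n%:R.
  exists (Num.truncn `|- ln x|).+1.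
  by rewrite (le_trans (ler_norm _))// ltW// truncnS_gt.
by exists n => //=; rewrite in_itv/= andbT -[x in leRHS]lnK// ler_expR lerNl.
Qed.

(** Since [ln] is singular at 0, the substitution u = ln s is made on the rays [e^-n, oo[; monotone
    convergence then exhausts both domains. *)
Let ge0_integral_ln f : continuous f -> (forall u, 0 <= f u) ->
  (\int[mu]_(s in `]0%R, +oo[) (f (ln s) / s)%:E = \int[mu]_u (f u)%:E)%E.
Proof.
move=> cf f0.
have mf : measurable_fun [set: R] f by exact: continuous_measurable_fun.
have cl (s : R) : 0 < s -> {for s, continuous (fun s => f (ln s) / s)}.
  move=> s0; apply: cvgM; last by apply: cvgV; [rewrite gt_eqF|exact: cvg_id].
  by apply: continuous_cvg; [exact: cf|exact: continuous_ln].
have ml : measurable_fun `](0 : R), +oo[ (fun s : R => f (ln s) / s).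
  apply: open_continuous_measurable_fun; first exact: interval_open.
  by move=> s; rewrite inE/= in_itv/= andbT; exact: cl.
pose I n := (\int[mu]_(u in `[(- n%:R)%R, +oo[) (f u)%:E)%E.
have IE n : (\int[mu]_(s in `[expR (- n%:R), +oo[) (f (ln s) / s)%:E = I n)%E.
  rewrite /I; set a := expR _; have a0 : 0 < a by exact: expR_gt0.
  have -> : - n%:R = ln a by rewrite expRK.
  have dl (x : R) : 0 < x -> derive1 (@ln R) x = x^-1.
    by move=> x0; rewrite derive1E; have /@derive_val := is_derive1_ln x0.
  have near_dl (x : R) : 0 < x -> \forall z \near x, z^-1 = derive1 (@ln R) z.
    by move=> x0; near=> z; rewrite dl//; near: z; exact: lt_nbhsr.
  rewrite [RHS](@increasing_ge0_integration_by_substitutiony R (@ln R) f a)//.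
  - apply: eq_integral => s; rewrite inE/= in_itv/= andbT => ase.
    by rewrite !fctE/= dl// (lt_le_trans a0).
  - move=> x y; rewrite !in_itv/= !andbT => ax ay.
    by rewrite ltr_ln// posrE (lt_le_trans a0).
  - move=> x; rewrite in_itv/= andbT => ax.
    have x0 : 0 < x by rewrite (lt_trans a0).
    rewrite /continuous_at dl//; apply: cvg_trans (cvgV (lt0r_neq0 x0) cvg_id).
    by apply: near_eq_cvg; exact: near_dl.
  - apply/cvg_ex; exists a^-1; apply: cvg_at_right_filter.
    apply: cvg_trans (cvgV (lt0r_neq0 a0) cvg_id).
    by apply: near_eq_cvg; exact: near_dl.
  - apply/cvg_ex; exists 0.
    have : (fun x : R => x^-1) x @[x --> +oo] --> (0 : R).
      apply/gtr0_cvgV0; last exact: cvg_id.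
      exact: nbhs_pinfty_gt (num_real _).
    apply: cvg_trans; apply: near_eq_cvg; near=> z; rewrite dl//.
  - split.
      move=> x; rewrite in_itv/= andbT => ax.
      by apply: ex_derive; apply: is_derive1_ln; rewrite (lt_trans a0).
    by apply: cvg_at_right_filter; exact: continuous_ln.
  - apply/cvgryPge => A; near=> x.
    rewrite -[A]expRK ler_ln ?posrE ?expR_gt0//.
  - exact: continuous_subspaceT.
have <- : limn I = (\int[mu]_u (f u)%:E)%E.
  rewrite -bigcup_itvNy; apply/cvg_lim => //.
  apply: ge0_nondecreasing_set_cvg_integral => //=.
  - apply/nondecreasing_seqP => n; rewrite subsetEset; apply: subset_itvr.
    by rewrite bnd_simp lerN2 ler_nat.
  - by move=> n; apply/measurable_EFinP; exact: measurable_funTS.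
  - by move=> n x _; rewrite lee_fin.
rewrite -bigcup_itv0y; apply/esym/cvg_lim => //.
rewrite (_ : I = fun n => (\int[mu]_(s in `[expR (- n%:R), +oo[) (f (ln s) / s)%:E)%E); last first.
  by apply/funext => n; rewrite IE.
have sub n : `[expR (- n%:R) : R, +oo[ `<=` `]0, +oo[%classic.
  by move=> x/=; rewrite !in_itv/= !andbT; apply: lt_le_trans; exact: expR_gt0.
apply: ge0_nondecreasing_set_cvg_integral => //=.
- apply/nondecreasing_seqP => n; rewrite subsetEset; apply: subset_itvr.
  by rewrite bnd_simp ler_expR lerN2 ler_nat.
- move=> n; apply/measurable_EFinP; exact: measurable_funS ml.
- move=> n x /sub/=; rewrite in_itv/= andbT => x0.
  by rewrite lee_fin divr_ge0// ltW.
Unshelve. all: by end_near. Qed.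

Lemma integral_ln f : continuous f ->
  (\int[mu]_(s in `]0%R, +oo[) (f (ln s) / s)%:E = \int[mu]_u (f u)%:E)%E.
Proof.
have maxE (h : R -> R) s : s \in `]0%R, +oo[%classic ->
    Num.max (h (ln s)) 0 / s = Num.max (h (ln s) / s) 0.
  rewrite inE/= in_itv/= andbT => s0.
  by rewrite maxr_pMl ?mul0r// invr_ge0 ltW.
move=> cf; apply: eq_integral_maxr.
- rewrite -(ge0_integral_ln (continuous_maxr0 cf)); last first.
    by move=> u; rewrite le_max lexx orbT.
  by apply: eq_integral => s s0; rewrite maxE.
- have cNf : continuous (fun u => - f u) by move=> u; apply: cvgN; exact: cf.
  rewrite -(ge0_integral_ln (continuous_maxr0 cNf)); last first.
    by move=> u; rewrite le_max lexx orbT.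
  by apply: eq_integral => s s0; rewrite (maxE (\- f))// mulNr.
Qed.

Let ge0_integral_sym f : continuous f -> (forall u, 0 <= f u) ->
  (\int[mu]_(t in `[0%R, +oo[) (f t + f (- t))%:E = \int[mu]_u (f u)%:E)%E.
Proof.
move=> cf f0.
have mf : measurable_fun [set: R] (fun x => (f x)%:E).
  exact: continuous_measurable_EFin.
have mfN : measurable_fun [set: R] (fun x => (f (- x))%:E).
  by apply: continuous_measurable_EFin => //; exact: continuous_compN.
under eq_integral do rewrite EFinD.
rewrite ge0_integralD//=; first last.
- exact: measurable_funTS.
- by move=> *; rewrite lee_fin.
- exact: measurable_funTS.
- by move=> *; rewrite lee_fin.
rewrite (ge0_integration_by_substitution0 mfN)//.
under [X in (_ + X)%E]eq_integral do rewrite opprK.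
rewrite -[RHS](_ : (\int[mu]_(u in `[0%R, +oo[ `|` ~` `[0%R, +oo[) (f u)%:E)%E = _); last first.
  by rewrite setUv.
rewrite ge0_integral_setU//=.
- by rewrite setCitvr integral_itv_bndo_bndc//; exact: measurable_funTS.
- exact: measurableC.
- exact: measurable_funTS.
- by move=> *; rewrite lee_fin.
- exact/disj_setPCl.
- by move=> *; rewrite lee_fin.
Qed.

(** Cancellation may occur in f t + f (- t), so its positive part is not in general the sum of the
    positive parts. The reduction to nonnegative functions therefore goes through f = p - n and
    linearity, which uses integrability. *)
Lemma integral_even_part f : continuous f -> mu.-integrable setT (EFin \o f) ->
  (\int[mu]_(t in `[0%R, +oo[) (f t + f (- t))%:E = \int[mu]_u (f u)%:E)%E.
Proof.
move=> cf intf; have cNf : continuous (fun u => - f u).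
  by move=> u; apply: cvgN; exact: cf.
pose p u := Num.max (f u) 0; pose n u := Num.max (- f u) 0.
have p0 u : 0 <= p u by rewrite le_max lexx orbT.
have n0 u : 0 <= n u by rewrite le_max lexx orbT.
have fE u : f u = p u - n u.
  rewrite /p /n; have [u0|u0] := leP (f u) 0.
    by rewrite max_l ?oppr_ge0// sub0r opprK.
  by rewrite max_r ?subr0// oppr_le0 ltW.
have cp : continuous p by exact: continuous_maxr0.
have cn : continuous n by exact: continuous_maxr0 cNf.
have pE : (\int[mu]_u (p u)%:E = \int[mu]_u (EFin \o f)^\+ u)%E.
  by apply: eq_integral => u _; rewrite funeposE EFin_max.
have nE : (\int[mu]_u (n u)%:E = \int[mu]_u (EFin \o f)^\- u)%E.
  by apply: eq_integral => u _; rewrite funenegE EFin_max.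
have ieven (h : R -> R) : continuous h -> (forall u, 0 <= h u) ->
    (\int[mu]_u (h u)%:E < +oo)%E ->
    mu.-integrable `[0%R, +oo[ (EFin \o (fun t => h t + h (- t))).
  move=> ch h0 ih; apply/integrableP; split.
    apply: continuous_measurable_EFin => // u.
    apply: cvgD; first exact: ch.
    exact: continuous_compN.
  under eq_integral do rewrite /= ger0_norm ?addr_ge0//.
  by rewrite ge0_integral_sym.
rewrite [in RHS]integralE -pE -nE -!ge0_integral_sym// -integralB_EFin//.
- by apply: eq_integral => t _; rewrite -EFinB !fE opprD addrACA.
- by apply: ieven => //; rewrite pE; exact: integral_funepos_lt_pinfty.
- by apply: ieven => //; rewrite nE; exact: integral_funeneg_lt_pinfty.
Qed.

End integral_real_line.

(** * The gamma function *)

Section gamma_function.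
Context {R : realType}.
Notation mu := (@lebesgue_measure R).
Implicit Types (f g : R -> R) (a c x : R).

Lemma continuous_expR_abs a : continuous (fun u : R => expR (- (a * `|u|))).
Proof.
continuity. Qed.

Lemma cvg_expRNMy a : 0 < a -> expR (- (a * u)) @[u --> +oo] --> (0 : R).
Proof.
move=> a0; apply: (@cvg_comp _ _ _ (fun u => a * u) (fun v => expR (- v)) _ (pinfty_nbhs R)).
  exact: gt0_cvgMry.
exact: cvgr_expR.
Qed.

Lemma integral_expR_abs a : 0 < a ->
  (\int[mu]_u (expR (- (a * `|u|)))%:E = (2 / a)%:E)%E.
Proof.
move=> a0; have cf := @continuous_expR_abs a.
rewrite ge0_symfun_integralT//; last by move=> u; rewrite /= normrN.
have -> : [set x : R | 0 <= x] = `[0%R, +oo[%classic.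
  by apply/seteqP; split=> x /=; rewrite in_itv/= andbT.
rewrite (_ : (2 / a)%:E = 2%:E * (0%:E - (- (a^-1 * expR (- (a * 0))))%:E))%E; last first.
  by rewrite mulr0 oppr0 expR0 mulr1 sub0e EFinN oppeK EFinM.
congr (_ * _)%E.
have dF (x : R) : is_derive x (1 : R) (fun u => - (a^-1 * expR (- (a * u)))) (expR (- (a * x))).
  apply: is_derive_eq; rewrite /GRing.scale/= mulr1 !mulrN mulrCA !mulrA.
  by rewrite opprK divfK ?gt_eqF.
rewrite -(@ge0_continuous_FTC2y R (fun u => expR (- (a * u))) (fun u => - (a^-1 * expR (- (a * u)))) 0 0)//.
- apply: eq_integral => u; rewrite inE/= in_itv/= andbT => u0.
  by rewrite ger0_norm.
- by apply: continuous_subspaceT; continuity.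
- rewrite -oppr0 -(mulr0 a^-1); apply: cvgN; apply: cvgM; first exact: cvg_cst.
  exact: cvg_expRNMy.
- apply: cvg_at_right_filter.
  by have : continuous (fun u => - (a^-1 * expR (- (a * u)))); [continuity|exact].
- by move=> x _; rewrite derive1E derive_val.
Qed.

Lemma integrable_expR_abs a : 0 < a ->
  mu.-integrable setT (EFin \o (fun u => expR (- (a * `|u|)))).
Proof.
move=> a0; apply/integrableP; split.
  by apply: continuous_measurable_EFin => //; exact: continuous_expR_abs.
under eq_integral do rewrite /= ger0_norm ?expR_ge0//.
by rewrite integral_expR_abs// ltry.
Qed.

(** This test serves both the gamma kernel and the integrand of the Macdonald function. *)
Lemma integrable_expR_dominated f a C : 0 < a -> continuous f ->
  (forall u, `|f u| <= C * expR (- (a * `|u|))) -> mu.-integrable setT (EFin \o f).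
Proof.
move=> a0 cf fC.
apply: (@le_integrable _ _ _ mu _ measurableT _ (fun u => (C * expR (- (a * `|u|)))%:E)).
- exact: continuous_measurable_EFin.
- move=> u _ /=; rewrite lee_fin; apply: le_trans (fC u) _; exact: ler_norm.
- by under eq_fun do rewrite EFinM; apply: integrableZl => //; exact: integrable_expR_abs.
Qed.

(** The maximum is reached at [m = ln (k / y)] and equals [k * (m - 1)]. The inequality is the
    tangent bound 1 + v <= e^v at v = u - m, multiplied by k. *)
Lemma linear_sub_expR_bounded (k y : R) : 0 < k -> 0 < y ->
  exists C, forall u : R, k * u - y * expR u <= C.
Proof.
move=> k0 y0; pose m := ln (k / y); exists (k * (m - 1)) => u.
have ky0 : 0 < k / y by rewrite divr_gt0.
have : k * (1 + (u - m)) <= y * expR u.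
  have -> : y * expR u = k * expR (u - m).
    have -> : expR u = expR (u - m) * (k / y).
      by rewrite -[k / y]lnK// -expRD subrK.
    by field; rewrite gt_eqF.
  by rewrite ler_pM2l// expR_ge1Dx.
lra.
Qed.

(** Euler's integrand after s = e^u: the measure s^(a-1) e^-s ds becomes e^(a u - e^u) du. *)
Definition gammaker a u := expR (a * u - expR u).

Lemma gammaker_gt0 a u : 0 < gammaker a u. Proof. exact: expR_gt0. Qed.

Lemma continuous_gammaker a : continuous (gammaker a).
Proof. by rewrite /gammaker; continuity. Qed.

Lemma gammaker_dominated a : 0 < a ->
  exists C, forall u, gammaker a u <= C * expR (- (a * `|u|)).
Proof.
(* The slope [2 * a] leaves a factor e^(-a u) to spare for u >= 0; for u <= 0 the factor e^(a u) is
   already the required decay. *)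
move=> a0; have [|C hC] := @linear_sub_expR_bounded (2 * a) 1 _ ltr01.
  by rewrite mulr_gt0.
exists (expR `|C|) => u; rewrite -expRD ler_expR.
have u0 := expR_gt0 u; have C1 := ler_norm C; have C0 := normr_ge0 C.
have [/ger0_norm ->|/ltW/ler0_norm ->] := leP 0 u; last by lra.
by have := hC u; rewrite mul1r; lra.
Qed.

Lemma integrable_gammaker a : 0 < a -> mu.-integrable setT (EFin \o gammaker a).
Proof.
move=> a0; have [C hC] := gammaker_dominated a0.
apply: (integrable_expR_dominated a0 (@continuous_gammaker a)) => u.
by rewrite ger0_norm ?hC// ltW ?gammaker_gt0.
Qed.

Lemma GammaE a : Gamma a = \int[mu]_u gammaker a u.
Proof.
rewrite /Gamma /Rintegral -(integral_ln (@continuous_gammaker a)); congr fine.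
apply: eq_integral => s; rewrite inE/= in_itv/= andbT => s0.
rewrite /powR gt_eqF// /gammaker lnK ?posrE//; congr EFin.
by rewrite -[in RHS](lnK s0) -expRN -!expRD; congr expR; rewrite lnK//; ring.
Qed.

Lemma integral_gammaker a : 0 < a ->
  (\int[mu]_u (gammaker a u)%:E = (Gamma a)%:E)%E.
Proof.
by move=> a0; rewrite GammaE /Rintegral fineK//; apply: integrable_fin_num => //; exact: integrable_gammaker.
Qed.

(** On [0, 1] the integrand is at least e^-e, because 0 <= a u and e^u <= e. *)
Lemma Gamma_gt0 a : 0 < a -> 0 < Gamma a.
Proof.
move=> a0; rewrite -lte_fin -integral_gammaker//.
have m01 : measurable (`[0%R, 1%R]%classic : set R) by [].
apply: (@lt_le_trans _ _ (\int[mu]_(u in `[0%R, 1%R]) (expR (- expR 1))%:E)%E).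
  rewrite integral_cst//= lebesgue_measure_itv/= lte01 oppr0 adde0 mule1.
  by rewrite lte_fin expR_gt0.
apply: (@le_trans _ _ (\int[mu]_(u in `[0%R, 1%R]) (gammaker a u)%:E)%E).
  apply: ge0_le_integral => //.
  - exact: continuous_measurable_EFin (@continuous_gammaker a).
  - move=> u /=; rewrite in_itv/= => /andP[u0 u1].
    rewrite lee_fin ler_expR -[leLHS]add0r lerD ?mulr_ge0 ?(ltW a0)//.
    by rewrite lerN2 ler_expR.
apply: ge0_subset_integral => //.
- exact: continuous_measurable_EFin (@continuous_gammaker a).
- by move=> u _; rewrite lee_fin ltW ?gammaker_gt0.
Qed.

Lemma is_derive_gammaker a (x : R) :
  is_derive x (1 : R) (gammaker a) (a * gammaker a x - gammaker (a + 1) x).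
Proof.
rewrite /gammaker; apply: is_derive_eq; rewrite /GRing.scale/= mulrDl mul1r.
have -> : a * x + x - expR x = (a * x - expR x) + x by ring.
by rewrite [expR (_ + x)]expRD; ring.
Qed.

Let bigcup_itvNn : \bigcup_n `[- n%:R, n%:R]%classic = [set: R].
Proof.
apply/seteqP; split=> // x _; exists (Num.truncn `|x|).+1 => //=.
by rewrite in_itv/= -ler_norml ltW// truncnS_gt.
Qed.

Let cvg_integral_gammaker a : 0 < a ->
  (\int[mu]_(u in `[(- n%:R)%R, n%:R]) gammaker a u) @[n --> \oo] --> Gamma a.
Proof.
move=> a0; apply: fine_cvg; rewrite -integral_gammaker// -bigcup_itvNn.
apply: ge0_nondecreasing_set_cvg_integral => //=.
- apply/nondecreasing_seqP => n; rewrite subsetEset; apply: subset_itv.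
    by rewrite bnd_simp lerN2 ler_nat.
  by rewrite bnd_simp ler_nat.
- by move=> n; exact: continuous_measurable_EFin (@continuous_gammaker a).
- by move=> n x _; rewrite lee_fin ltW ?gammaker_gt0.
Qed.

Let cvg_gammaker a (s : R) : 0 < a -> `|s| = 1 ->
  gammaker a (s * n%:R) @[n --> \oo] --> (0 : R).
Proof.
move=> a0 s1; have [C hC] := gammaker_dominated a0.
apply: (@squeeze_cvgr _ _ _ _ (cst 0) (fun n : nat => C * expR (- (a * n%:R)))).
- apply: nearW => n; rewrite ltW ?gammaker_gt0//=.
  by have := hC (s * n%:R); rewrite normrM s1 mul1r ger0_norm.
- exact: cvg_cst.
- rewrite -(mulr0 C); apply: cvgM; first exact: cvg_cst.
  apply: (@cvg_comp _ _ _ (fun n : nat => n%:R) (fun v => expR (- (a * v))) _ (pinfty_nbhs R)).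
    exact: cvgr_idn.
  exact: cvg_expRNMy.
Qed.

(** Integration by parts: [a * gammaker a - gammaker (a + 1)] is the derivative of [gammaker a], so
    its integral over a symmetric interval is a boundary term, which tends to 0. *)
Lemma Gamma_rec a : 0 < a -> Gamma (a + 1) = a * Gamma a.
Proof.
move=> a0; have a10 : 0 < a + 1 by lra.
apply/esym/eqP; rewrite -subr_eq0; apply/eqP.
have igk b n : 0 < b -> mu.-integrable `[(- n%:R)%R, n%:R] (EFin \o gammaker b).
  by move=> b0; apply: integrableS (integrable_gammaker b0).
(* The index [n.+1] keeps the interval nondegenerate, as the fundamental theorem of calculus
   requires. *)
pose I b (n : nat) := \int[mu]_(u in `[(- n.+1%:R)%R, n.+1%:R]) gammaker b u.
have cI b : 0 < b -> I b n @[n --> \oo] --> Gamma b.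
  by move=> b0; have := cvg_integral_gammaker b0; rewrite -cvg_shiftS.
have cl : (a * I a n - I (a + 1) n) @[n --> \oo] --> a * Gamma a - Gamma (a + 1).
  by apply: cvgB; [apply: cvgM; [exact: cvg_cst|exact: cI]|exact: cI].
apply: (cvg_unique _ cl) => //.
have E n : a * I a n - I (a + 1) n = gammaker a (1 * n.+1%:R) - gammaker a (- 1 * n.+1%:R).
  rewrite mul1r mulN1r /I -RintegralZl//; last exact: igk.
  rewrite -RintegralB//; [|exact: integrableZl (igk _ _ a0)|exact: igk].
  rewrite /Rintegral (@continuous_FTC2 _ _ (gammaker a))//.
  - by rewrite ltrNl (lt_le_trans _ (ler0n _ _))// ltrNl oppr0 ltr0n.
  - apply: continuous_subspaceT; rewrite /gammaker; continuity.
  - split.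
    + by move=> x _; apply: ex_derive; exact: is_derive_gammaker.
    + by apply: cvg_at_right_filter; exact: continuous_gammaker.
    + by apply: cvg_at_left_filter; exact: continuous_gammaker.
  - move=> x _; rewrite derive1E.
    by have /@derive_val := is_derive_gammaker a x.
suff : (gammaker a (1 * n.+1%:R) - gammaker a (- 1 * n.+1%:R)) @[n --> \oo] --> (0 - 0 : R).
  by rewrite subrr; under [in X in X -> _]eq_fun do rewrite -E.
apply: cvgB.
- have := @cvg_gammaker a 1 a0 (normr1 _).
  by rewrite -(cvg_shiftS (fun n : nat => gammaker a (1 * n%:R))).
- have := @cvg_gammaker a (-1) a0 (normrN1 _).
  by rewrite -(cvg_shiftS (fun n : nat => gammaker a (-1 * n%:R))).
Qed.

(** With p = e^w this is the integral of s^(a-1) e^(-p s), equal to p^-a Gamma(a); the scaling of s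
    has become a translation of u. *)
Lemma integral_gammaker_scale a w : 0 < a ->
  (\int[mu]_u (expR (a * u - expR (u + w)))%:E = (expR (- (a * w)) * Gamma a)%:E)%E.
Proof.
move=> a0; rewrite EFinM -integral_gammaker//.
rewrite -(integral_shift w (@continuous_gammaker a)) -ge0_integralZl_EFin//.
- by apply: eq_integral => u _; rewrite /gammaker -EFinM -expRD; congr (expR _)%:E; ring.
- by move=> u _; rewrite lee_fin ltW ?gammaker_gt0.
- apply: continuous_measurable_EFin => //; rewrite /gammaker; continuity.
Qed.

Lemma integrable_gammaker_scale a w : 0 < a ->
  mu.-integrable setT (EFin \o (fun u => expR (a * u - expR (u + w)))).
Proof.
move=> a0; apply/integrableP; split.
  by apply: continuous_measurable_EFin => //; continuity.
under eq_integral do rewrite /= ger0_norm ?expR_ge0//.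
by rewrite integral_gammaker_scale// ltry.
Qed.

Lemma integrable_gammaker_cos c tau phi w : 0 < c ->
  mu.-integrable setT
    (EFin \o (fun u => expR (c * u - expR (u + w)) * cos (phi + tau * u))).
Proof.
move=> c0; apply: (@le_integrable _ _ _ mu _ measurableT _ _ _ _ (integrable_gammaker_scale w c0)).
  by apply: continuous_measurable_EFin => //; continuity.
by move=> u _ /=; rewrite lee_fin normrM; apply: ler_piMr => //; exact: cos_max.
Qed.

(** The left side is |Re (e^(i psi) (A + i B))|. The square [h1] belongs to the imaginary part, and
    the two squares add up to A^2 + B^2. *)
Lemma norm_cos_sin_le (psi A B : R) :
  `|cos psi * A - sin psi * B| <= complex_norm (A +i* B).
Proof.
rewrite /ComplexField.Normc.normc -sqrtr_sqr; apply: ler_wsqrtr.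
have := cos2Dsin2 psi; have := sqr_ge0 (cos psi * B + sin psi * A).
set C := cos psi; set S := sin psi => h1 h2.
have -> : A ^+ 2 + B ^+ 2 = (C ^+ 2 + S ^+ 2) * (A ^+ 2 + B ^+ 2) by rewrite h2 mul1r.
nra.
Qed.

(** Translation by [w] turns the integral into e^(-c w) Re (e^(i psi) Gamma(c + i tau)), where the
    phase psi = phi - tau w absorbs the shift. *)
Lemma integral_gammaker_cos_bound c tau phi w : 0 < c ->
  `|\int[mu]_u (expR (c * u - expR (u + w)) * cos (phi + tau * u))| <=
  expR (- (c * w)) * complex_norm (cGamma (c +i* tau)).
Proof.
move=> c0; pose h (trig : R -> R) u := gammaker c u * trig (tau * u).
have hE (trig : R -> R) : continuous trig ->
  \int[mu]_u h trig u = \int[mu]_(s in `]0, +oo[) (expR ((c - 1) * ln s) * trig (tau * ln s) * expR (- s)).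
  move=> ct; rewrite /Rintegral -(@integral_ln _ (h trig)); last first.
    by rewrite /h /gammaker; continuity.
  congr fine; apply: eq_integral => s; rewrite inE/= in_itv/= andbT => s0.
  rewrite /h /gammaker lnK ?posrE//; congr EFin.
  have -> : s^-1 = expR (- ln s) by rewrite expRN lnK.
  by rewrite mulrAC [RHS]mulrAC -!expRD; congr (expR _ * _); ring.
have GE : cGamma (c +i* tau) = (\int[mu]_u h cos u) +i* (\int[mu]_u h sin u).
  rewrite /cGamma /cintegral (hE cos (@continuous_cos R)) (hE sin (@continuous_sin R)).
  congr (_ +i* _); apply: eq_Rintegral => s _; rewrite /cexp /=.
    by rewrite !(mulr0, subr0, addr0, add0r).
  by rewrite !(mulr0, subr0, addr0, add0r).
have ih (trig : R -> R) : continuous trig -> (forall u, `|trig u| <= 1) ->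
    mu.-integrable setT (EFin \o h trig).
  move=> ct t1; apply: (@le_integrable _ _ _ mu _ measurableT _ (EFin \o gammaker c)) => //.
  - by apply: continuous_measurable_EFin => //; rewrite /h /gammaker; continuity.
  - move=> u _ /=; rewrite lee_fin normrM; apply: ler_piMr => //.
  - exact: integrable_gammaker.
have ihc := ih _ (@continuous_cos R) (@cos_max R).
have ihs := ih _ (@continuous_sin R) (@sin_max R).
pose psi := phi - tau * w.
have -> : \int[mu]_u (expR (c * u - expR (u + w)) * cos (phi + tau * u)) =
    expR (- (c * w)) * (cos psi * (\int[mu]_u h cos u) - sin psi * (\int[mu]_u h sin u)).
  rewrite -!RintegralZl// -RintegralB//; [|exact: integrableZl ihc|exact: integrableZl ihs].
  rewrite -RintegralZl//; last first.
    exact: (integrableB measurableT (integrableZl measurableT (cos psi) ihc)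
                        (integrableZl measurableT (sin psi) ihs)).
  pose f u := expR (- (c * w)) * (cos psi * h cos u - sin psi * h sin u).
  rewrite /Rintegral -(@integral_shift _ f w); last by rewrite /f /h /gammaker; continuity.
  congr fine; apply: eq_integral => u _; rewrite /f /h /gammaker; congr EFin.
  have -> : phi + tau * u = psi + tau * (u + w) by rewrite /psi; ring.
  have -> : expR (c * u - expR (u + w)) = expR (- (c * w)) * expR (c * (u + w) - expR (u + w)).
    by rewrite -expRD; congr expR; ring.
  by rewrite cosD; ring.
rewrite normrM ger0_norm ?expR_ge0// ler_wpM2l ?expR_ge0// GE.
exact: norm_cos_sin_le.
Qed.

End gamma_function.

#[local] Opaque Gamma.

(** * The Bessel series and its growth *)

Section exponential_type_series.
Context {R : realType}.
Implicit Types (c : nat -> R) (y : R).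

(** These are the coefficients of entire functions of exponential type. The class is stable under
    differentiation, so one coefficient estimate gives the convergence of all derived series. *)
Definition exp_type c := exists M r : R,
  [/\ 0 <= M, 0 <= r & forall k, `|c k| <= M * r ^+ k / k`!%:R].

Lemma is_cvg_norm_pseries c y : exp_type c ->
  cvgn (series (fun k => `|c k * y ^+ k|)).
Proof.
move=> [M [r [M0 r0 hc]]].
apply: (@series_le_cvg _ _ (M *: exp_coeff (r * `|y|))) => [k|k|k|] //.
- by rewrite !fctE mulr_ge0// exp_coeff_ge0// mulr_ge0.
- rewrite !fctE /exp_coeff/= /GRing.scale/= normrM normrX exprMn.
  rewrite [leRHS](_ : _ = M * r ^+ k / k`!%:R * `|y| ^+ k); last by ring.
  by rewrite ler_wpM2r// exprn_ge0.
- by apply: is_cvg_seriesZ; exact: is_cvg_series_exp_coeff.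
Qed.

Lemma is_cvg_pseries c y : exp_type c -> cvgn (pseries c y).
Proof. by move=> hc; apply: normed_cvg; exact: is_cvg_norm_pseries. Qed.

Lemma exp_type_diffs c : exp_type c -> exp_type (pseries_diffs c).
Proof.
move=> [M [r [M0 r0 hc]]]; exists (M * r), r; split => //; first exact: mulr_ge0.
move=> k; rewrite /pseries_diffs normrM ger0_norm//.
apply: le_trans (ler_wpM2l (ler0n _ _) (hc k.+1)) _.
rewrite factS natrM exprS [leLHS](_ : _ = M * r * r ^+ k / k`!%:R)//.
by field; rewrite nat1r !pnatr_eq0 -lt0n fact_gt0.
Qed.

Lemma is_derive_pseries c y : exp_type c ->
  is_derive y (1 : R) (fun y => limn (pseries c y)) (limn (pseries (pseries_diffs c) y)).
Proof.
move=> hc; have hd := exp_type_diffs hc; have hdd := exp_type_diffs hd.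
apply: (@pseries_snd_diffs _ _ (`|y| + 1)); [exact: is_cvg_pseries..|].
by rewrite [ltRHS]ger0_norm ?ltrDl// addr_ge0.
Qed.

(** The recurrence is the equation y j'' + (nu + 1) j' + j = 0 read coefficient by coefficient. It
    is Bessel's equation for (t/2)^nu j(t^2/4). *)
Lemma pseries_bessel_ode c nu y : exp_type c ->
  (forall k, k.+1%:R * (nu + k%:R + 1) * c k.+1 = - c k) ->
  let j1 := limn (pseries (pseries_diffs c) y) in
  let j2 := limn (pseries (pseries_diffs (pseries_diffs c)) y) in
  y * j2 + (nu + 1) * j1 + limn (pseries c y) = 0.
Proof.
move=> e0 cS j1 j2.
have e1 := exp_type_diffs e0; have e2 := exp_type_diffs e1.
set d := pseries_diffs c in j1 j2 e1 e2 *.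
have c0 : pseries c y @ \oo --> limn (pseries c y) by exact: is_cvg_pseries.
have c1 : pseries d y @ \oo --> j1 by exact: is_cvg_pseries.
have c2 := pseries_diffs_equiv (@is_cvg_pseries _ y e2).
rewrite -/d -/j2 in c2.
(* With j'' written as the sum of i d_i y^(i-1), the three sums have matching powers of y, so that
   every partial sum is exactly 0. *)
pose s (n : nat) := y * series (fun i => i%:R * d i * y ^+ i.-1) n +
  (nu + 1) * pseries d y n + pseries c y n.
have cs : s @ \oo --> y * j2 + (nu + 1) * j1 + limn (pseries c y).
  apply: cvgD => //; apply: cvgD; (apply: cvgM; first exact: cvg_cst) => //.
have -> // : y * j2 + (nu + 1) * j1 + limn (pseries c y) = limn s by apply/esym/cvg_lim.
have -> : s = cst 0.
  apply/funext => n; rewrite /s !fctE /pseries /series/= !mulr_sumr -!big_split/=.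
  apply: big1_seq => i _; have := cS i; rewrite /d /pseries_diffs.
  case: i => [|i] h.
    rewrite [LHS](_ : _ = 1%:R * (nu + 0%:R + 1) * c 1 + c 0).
      by rewrite h addNr.
    by rewrite expr0; ring.
  rewrite /= exprS.
  rewrite [LHS](_ : _ = y * y ^+ i * (i.+2%:R * (nu + i.+1%:R + 1) * c i.+2 + c i.+1)); last by ring.
  by rewrite h addNr mulr0.
exact: lim_cst.
Qed.

End exponential_type_series.

(** * The entire factor of the Bessel function *)

Section bessel_entire.
Context {R : realType}.
Context (nu : R) (hnu : - (1 / 2) <= nu).
Implicit Types (t y : R).

Definition bessel_coeff (k : nat) : R :=
  (-1) ^+ k / (k`!%:R * Gamma (nu + k%:R + 1)).

(** The function j with J_nu(t) = (t/2)^nu j(t^2/4) for t > 0; it separates the real power from a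
    series to which termwise calculus applies. *)
Definition bessel_entire y : R := limn (pseries bessel_coeff y).

Let bessel_arg_gt0 (k : nat) : 0 < nu + k%:R + 1.
Proof. by have h := hnu; have := ler0n R k; lra. Qed.

Lemma Gamma_natS k : Gamma (nu + k.+1%:R + 1) = (nu + k%:R + 1) * Gamma (nu + k%:R + 1).
Proof.
have -> : nu + k.+1%:R + 1 = nu + k%:R + 1 + 1 by rewrite -natr1; ring.
by rewrite Gamma_rec.
Qed.

Lemma norm_bessel_coeff k :
  `|bessel_coeff k| = (k`!%:R * Gamma (nu + k%:R + 1))^-1.
Proof.
rewrite /bessel_coeff normrM normrX normrN1 expr1n mul1r ger0_norm// invr_ge0.
by rewrite mulr_ge0// ltW// Gamma_gt0.
Qed.

Lemma bessel_coeffS k :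
  k.+1%:R * (nu + k%:R + 1) * bessel_coeff k.+1 = - bessel_coeff k.
Proof.
have f0 : k`!%:R != 0 :> R by rewrite pnatr_eq0 -lt0n fact_gt0.
rewrite /bessel_coeff Gamma_natS factS natrM exprS; field.
by rewrite f0 nat1r pnatr_eq0/= gt_eqF ?Gamma_gt0//= gt_eqF.
Qed.

(** Since nu >= -1/2, each ratio nu + k + 1 of consecutive gamma values is at least 1/2, whence
    Gamma(nu + k + 1) >= 2^-k Gamma(nu + 1). *)
Lemma exp_type_bessel_coeff : exp_type bessel_coeff.
Proof.
pose G (k : nat) := Gamma (nu + k%:R + 1).
have G0 k : 0 < G k by exact: Gamma_gt0.
have GS k : G k.+1 = (nu + k%:R + 1) * G k by exact: Gamma_natS.
have GE k : `|bessel_coeff k| = (k`!%:R * G k)^-1 by exact: norm_bessel_coeff.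
move: (G) G0 GS GE => {}G G0 GS GE.
have G2 k : G 0%N <= 2 ^+ k * G k.
  elim: k => [|k IH]; first by rewrite expr0 mul1r.
  apply: le_trans IH _; rewrite exprS GS.
  rewrite [leRHS](_ : _ = (2 * (nu + k%:R + 1)) * (2 ^+ k * G k)); last by ring.
  apply: ler_peMl; first by rewrite mulr_ge0 ?exprn_ge0 ?(ltW (G0 k)).
  by have h := hnu; have := ler0n R k; lra.
exists (G 0%N)^-1, 2; split => //; first by rewrite invr_ge0 ltW.
move=> k; rewrite GE invfM mulrC ler_wpM2r ?invr_ge0//.
by rewrite ler_pdivlMl// ler_pdivrMr.
Qed.

Lemma continuous_bessel_entire : continuous bessel_entire.
Proof.
move=> y; apply: differentiable_continuous; apply/derivable1_diffP.
by apply: ex_derive; apply: is_derive_pseries; exact: exp_type_bessel_coeff.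
Qed.

End bessel_entire.

(** * Finiteness of the supremum c_nu *)

Section bessel_bounded.
Context {R : realType}.

(* Along a solution of u'' = - (1 - k / t^2) u the energy u^2 + u'^2 times
   exp (|k| / t) is nonincreasing. *)
Lemma energy_bounded (u v : R -> R) (k : R) :
  (forall t : R, 1 <= t -> is_derive t (1 : R) u (v t)) ->
  (forall t : R, 1 <= t -> is_derive t (1 : R) v (- u t * (1 - k / t ^+ 2))) ->
  exists M, forall t, 1 <= t -> `|u t| <= M.
Proof.
move=> du dv.
pose F t := (u t ^+ 2 + v t ^+ 2) * expR (`|k| * t^-1).
pose dF t := expR (`|k| * t^-1) / t ^+ 2 * (2 * u t * v t * k - `|k| * (u t ^+ 2 + v t ^+ 2)).
have FdF (t : R) : 1 <= t -> is_derive t (1 : R) F (dF t).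
  move=> t1; have t0 : t != 0 by rewrite gt_eqF// (lt_le_trans _ t1).
  have := du _ t1 => dut; have := dv _ t1 => dvt.
  have dV : is_derive t (1 : R) (fun t => t^-1) (- t ^- 2).
    have := @is_deriveV R id t 1 1 t0 (is_derive_id t 1).
    by rewrite /GRing.scale/= mulr1.
  rewrite /F; apply: is_derive_eq; rewrite /dF /GRing.scale/=.
  by field.
have F1 t : 1 <= t -> F t <= F 1.
  rewrite le_eqVlt => /predU1P[<-//|t1].
  have [| |c] := @MVT _ F dF _ _ t1.
  - by move=> x; rewrite in_itv/= => /andP[x1 _]; apply: FdF; rewrite ltW.
  - apply: derivable_within_continuous => x; rewrite in_itv/= => /andP[x1 _].
    by apply: ex_derive; exact: FdF.
  rewrite in_itv/= => /andP[c1 ct] Fc; rewrite -subr_le0 Fc.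
  rewrite mulr_le0_ge0 ?subr_ge0 ?(ltW t1)// /dF mulr_ge0_le0//.
    by rewrite divr_ge0 ?expR_ge0// exprn_even_ge0.
  (* The second factor of [dF] is nonpositive because 2 |u v| <= u^2 + v^2. *)
  have := ler_norm k; have := ler_norm (- k); rewrite normrN.
  have := sqr_ge0 (u c + v c); have := sqr_ge0 (u c - v c); nra.
(* From u^2 <= F 1, the inequality |u| <= 1 + u^2 gives a bound without a square root. *)
exists (1 + F 1) => t t1.
have h : u t ^+ 2 <= F 1.
  apply: le_trans (F1 _ t1); rewrite /F.
  have : 1 <= expR (`|k| * t^-1).
    by rewrite -[leLHS]expR0 ler_expR mulr_ge0// invr_ge0 (le_trans _ t1).
  by have := sqr_ge0 (u t); have := sqr_ge0 (v t); nra.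
rewrite -[u t ^+ 2]real_normK ?num_real// in h.
by have := normr_ge0 (u t); nra.
Qed.

Lemma besselJE (nu t : R) : - (1 / 2) <= nu -> 0 < t ->
  besselJ nu t = (t / 2) `^ nu * bessel_entire nu (t ^+ 2 / 4).
Proof.
move=> hnu t0; have t20 : 0 < t / 2 by rewrite divr_gt0.
rewrite /besselJ /bessel_entire.
have := @lim_seriesZ _ (fun k => bessel_coeff nu k * (t ^+ 2 / 4) ^+ k) ((t / 2) `^ nu).
rewrite /GRing.scale/= => <-; last exact: (is_cvg_pseries (exp_type_bessel_coeff hnu)).
congr (limn (series _)); apply/funext => k.
rewrite powRD; last by rewrite [t / 2 == 0]gt_eqF ?implybT.
have -> : (t / 2) `^ (2 * k%:R) = (t ^+ 2 / 4) ^+ k.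
  rewrite -natrM powR_mulrn ?(ltW t20)// exprM; congr (_ ^+ k).
  by field.
by rewrite [LHS]mulrCA.
Qed.

Lemma sqrt_besselJE (nu t : R) : - (1 / 2) <= nu -> 0 < t ->
  sqrt_besselJ nu t =
  2 `^ (- nu) * (t `^ (nu + 1 / 2) * `|bessel_entire nu (t ^+ 2 / 4)|).
Proof.
move=> hnu t0; rewrite /sqrt_besselJ gt_eqF//= besselJE// normrM.
rewrite ger0_norm ?powR_ge0// -powR12_sqrt ?(ltW t0)// !mulrA; congr (_ * _).
rewrite powRM ?invr_ge0 ?(ltW t0)// powRD; last by rewrite [t == 0]gt_eqF ?implybT.
have -> : (2^-1 : R) `^ nu = 2 `^ (- nu) by rewrite -powR_inv1// -powRrM mulN1r.
by rewrite mul1r; ring.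
Qed.

(** Up to the factor 2^nu this is sqrt t |J_nu(t)|. The function u(t) = t^al j(t^2/4), with al = nu
    + 1/2, satisfies the equation of [energy_bounded] for k = al^2 - al = nu^2 - 1/4. *)
Lemma bessel_bounded_at_infinity (nu : R) : - (1 / 2) <= nu ->
  exists M, forall t, 1 <= t ->
    t `^ (nu + 1 / 2) * `|bessel_entire nu (t ^+ 2 / 4)| <= M.
Proof.
move=> hnu; set al := nu + 1 / 2.
have e0 := exp_type_bessel_coeff hnu; have e1 := exp_type_diffs e0.
pose j0 := bessel_entire nu.
pose j1 y := limn (pseries (pseries_diffs (bessel_coeff nu)) y).
pose j2 y := limn (pseries (pseries_diffs (pseries_diffs (bessel_coeff nu))) y).
have dj0 y : is_derive y (1 : R) j0 (j1 y) by exact: is_derive_pseries.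
have dj1 y : is_derive y (1 : R) j1 (j2 y) by exact: is_derive_pseries.
have ode y : y * j2 y + (nu + 1) * j1 y + j0 y = 0.
  by apply: pseries_bessel_ode => // k; exact: bessel_coeffS.
rewrite -/j0; move: (j0) (j1) (j2) dj0 dj1 ode => {e0 e1 j0 j1 j2} j0 j1 j2 dj0 dj1 ode.
(* [J1] and [J2] are j' and j'' evaluated at t^2/4, not derivatives in t; each differentiation in t
   brings out a factor t/2. *)
pose J0 t := j0 (t ^+ 2 / 4); pose J1 t := j1 (t ^+ 2 / 4); pose J2 t := j2 (t ^+ 2 / 4).
have dq (t : R) : is_derive t (1 : R) (fun t => t ^+ 2 / 4) (t / 2).
  by apply: is_derive_eq; rewrite /GRing.scale/=; field.
have dJ0 (t : R) : is_derive t (1 : R) J0 (J1 t * (t / 2)) by exact: is_derive1_comp.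
have dJ1 (t : R) : is_derive t (1 : R) J1 (J2 t * (t / 2)) by exact: is_derive1_comp.
have J2E (t : R) : t != 0 -> J2 t = 4 / t ^+ 2 * (- (nu + 1) * J1 t - J0 t).
  move=> t0; have := ode (t ^+ 2 / 4); rewrite -/(J0 t) -/(J1 t) -/(J2 t) => h.
  have -> : - (nu + 1) * J1 t - J0 t = t ^+ 2 / 4 * J2 t by lra.
  by field.
pose p (t : R) := t `^ al.
have dp (t : R) : 0 < t -> is_derive t (1 : R) p (al * t^-1 * p t).
  move=> t0; have := is_derive1_powR al t0.
  have -> // : al * t `^ (al - 1) = al * t^-1 * p t.
  rewrite powRD; last by rewrite [t == 0]gt_eqF ?implybT.
  by rewrite powR_inv1 ?ltW// /p; ring.
have dV (t : R) : 0 < t -> is_derive t (1 : R) (fun t => t^-1) (- t ^- 2).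
  move=> t0; have := @is_deriveV R id t 1 1 (lt0r_neq0 t0) (is_derive_id t 1).
  by rewrite /GRing.scale/= mulr1.
have [] := @energy_bounded (fun t => p t * J0 t)
  (fun t => p t * (al * t^-1 * J0 t + t / 2 * J1 t)) (al ^+ 2 - al).
- move=> t t1; have t0 : 0 < t by rewrite (lt_le_trans _ t1).
  have := dp t t0; have := dJ0 t; move=> ? ?.
  apply: is_derive_eq; rewrite /GRing.scale/=; ring.
- move=> t t1; have t0 : 0 < t by rewrite (lt_le_trans _ t1).
  have := dp t t0; have := dJ0 t; have := dJ1 t; have := dV t t0; move=> ? ? ? ?.
  have tn0 : t != 0 by rewrite gt_eqF.
  apply: is_derive_eq; rewrite /GRing.scale/= J2E// /al.
  by field.
- move=> M hM; exists M => t t1; have := hM t t1.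
  by rewrite normrM [`|p t|]ger0_norm// powR_ge0.
Qed.

(** The energy estimate covers t >= 1, and continuity of the entire factor on the compact interval
    [0, 1] covers 0 < t < 1. *)
Lemma sqrt_besselJ_bounded (nu : R) : - (1 / 2) <= nu ->
  has_ubound [set sqrt_besselJ nu t | t in `[0, +oo[].
Proof.
move=> hnu; have [M hM] := bessel_bounded_at_infinity hnu.
have cj : continuous (fun t : R => `|bessel_entire nu (t ^+ 2 / 4)|).
  apply: continuous_normR; apply: (continuous_compR (continuous_bessel_entire hnu)).
  by move=> y; apply: cvgM; [apply: cvgM; exact: cvg_id|exact: cvg_cst].
have [c _ hc] := @EVT_max R _ 0 1 ler01 (continuous_subspaceT cj).
pose K := 2 `^ (- nu) * (`|M| + `|bessel_entire nu (c ^+ 2 / 4)|).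
have K0 : 0 <= K by rewrite mulr_ge0 ?powR_ge0 ?addr_ge0.
(* The first summand takes care of t = 0, where the value may be defined as a limit; [K] bounds all
   t > 0. *)
exists (`|sqrt_besselJ nu 0| + K); move=> s [t /=]; rewrite in_itv/= andbT => t0 <-.
move: t0; rewrite le_eqVlt => /predU1P[<-|t0].
  by rewrite (le_trans (ler_norm _))// lerDl.
rewrite sqrt_besselJE// -[leLHS]add0r lerD// ler_wpM2l ?powR_ge0//.
have [t1|t1] := leP 1 t.
  by rewrite (le_trans (hM _ t1))// (le_trans (ler_norm _))// lerDl.
rewrite -[leLHS]add0r lerD// (le_trans _ (hc t _))//; last first.
  by rewrite in_itv/= !ltW.
(* The exponent nu + 1/2 is nonnegative, so the power is at most 1 here. *)
rewrite ler_piMl//; have : t `^ (nu + 1 / 2) <= 1 `^ (nu + 1 / 2).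
  apply: ge0_ler_powR; rewrite ?nnegrE//; [by lra|exact: ltW..].
by rewrite powR1.
Qed.

Lemma bessel_sup_ge (nu t : R) : - (1 / 2) <= nu -> 0 <= t ->
  sqrt_besselJ nu t <= bessel_sup nu.
Proof.
move=> hnu t0; apply: ub_le_sup; first exact: sqrt_besselJ_bounded.
by exists t => //=; rewrite in_itv/= andbT.
Qed.

End bessel_bounded.

(** * Weber's integral *)

Section weber_integral.
Context {R : realType}.
Notation mu := (@lebesgue_measure R).

Lemma nneseries_EFin_lty (a : nat -> R) : (forall k, 0 <= a k) ->
  cvgn (series a) -> (\sum_(0 <= k <oo) (a k)%:E < +oo)%E.
Proof.
move=> a0 ca; have -> : (fun n => \sum_(0 <= k < n) (a k)%:E)%E = EFin \o series a.
  by apply/funext => n; rewrite sumEFin.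
by rewrite EFin_lim// ltry.
Qed.

(* Weber's first exponential integral, for J_nu at 2 sqrt (X e^w): the dominated
   series can be integrated term by term. *)
Lemma weber_integral (nu X u : R) : - (1 / 2) <= nu -> 0 <= X ->
  (\int[mu]_w (expR ((nu + 1) * w - expR (w + u)) * bessel_entire nu (X * expR w))%:E =
   (expR (- ((nu + 1) * u)) * expR (- (X * expR (- u))))%:E)%E.
Proof.
move=> hnu X0.
pose E w := expR ((nu + 1) * w - expR (w + u)).
pose F (k : nat) w := bessel_coeff nu k * X ^+ k * expR ((nu + k%:R + 1) * w - expR (w + u)).
have FE k w : F k w = E w * (bessel_coeff nu k * (X * expR w) ^+ k).
  rewrite /F /E exprMn -expRM_natl.
  have -> : (nu + k%:R + 1) * w - expR (w + u) = (nu + 1) * w - expR (w + u) + k%:R * w by ring.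
  by rewrite [expR (_ + k%:R * w)]expRD; ring.
have nuk k : 0 < nu + k%:R + 1 by move: hnu (ler0n R k); lra.
have cF k : continuous (F k) by rewrite /F; continuity.
have G0 k : 0 < Gamma (nu + k%:R + 1) := Gamma_gt0 (nuk k).
have aFE k w : `|F k w| = `|bessel_coeff nu k| * X ^+ k * expR ((nu + k%:R + 1) * w - expR (w + u)).
  by rewrite /F !normrM [`|X ^+ k|]ger0_norm ?exprn_ge0// [`|expR _|]ger0_norm ?expR_ge0.
pose e0 := expR (- ((nu + 1) * u)).
have scaleE k : expR (- ((nu + k%:R + 1) * u)) = e0 * expR (- u) ^+ k.
  by rewrite /e0 -expRM_natl -expRD; congr expR; ring.
(* The gamma value produced by the scaled Euler integral cancels the one in the coefficient and
   leaves a term of the exponential series. *)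
have iaF k : (\int[mu]_w `|F k w|%:E = (e0 * exp_coeff (X * expR (- u)) k)%:E)%E.
  under eq_integral do rewrite aFE EFinM.
  rewrite ge0_integralZl_EFin//; first last.
  - by rewrite mulr_ge0// exprn_ge0.
  - by apply: continuous_measurable_EFin => //; continuity.
  rewrite integral_gammaker_scale// -EFinM norm_bessel_coeff// scaleE /exp_coeff/= exprMn.
  move: (G0 k) => Gk; congr EFin; field.
  by rewrite pnatr_eq0 -lt0n fact_gt0 gt_eqF.
have intF k : mu.-integrable setT (EFin \o F k).
  apply/integrableP; split; first exact: continuous_measurable_EFin.
  by under eq_integral do rewrite /=; rewrite iaF ltry.
have iF k : (\int[mu]_w (F k w)%:E = (e0 * exp_coeff (- (X * expR (- u))) k)%:E)%E.
  have ig := integrable_gammaker_scale u (nuk k).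
  rewrite /F; under eq_integral do rewrite EFinM.
  rewrite integralZl//= integral_gammaker_scale// -EFinM scaleE /bessel_coeff /exp_coeff/=.
  rewrite [(- (X * _)) ^+ k]exprNn exprMn; move: (G0 k) => Gk; congr EFin; field.
  by rewrite pnatr_eq0 -lt0n fact_gt0 gt_eqF.
pose f_ (n : nat) w := (\sum_(0 <= k < n) (F k w)%:E)%E.
have f_E n w : f_ n w = (E w * pseries (bessel_coeff nu) (X * expR w) n)%:E.
  by rewrite /f_ sumEFin /pseries /series/= mulr_sumr; congr EFin; apply: eq_bigr => k _.
pose f w := (E w * bessel_entire nu (X * expR w))%:E.
(* This dominates all partial sums; by [iaF] its integral is [e0] times the exponential series at X
   e^-u, hence finite. *)
pose g w := (\sum_(0 <= k <oo) `|F k w|%:E)%E.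
have mf_ n : measurable_fun setT (f_ n).
  by apply: emeasurable_sum => k; exact: continuous_measurable_EFin.
have maF k : measurable_fun setT (fun w => `|F k w|%:E).
  by apply: continuous_measurable_EFin => //; exact: continuous_normR.
have cb := continuous_bessel_entire hnu.
have mf : measurable_fun setT f.
  by apply: continuous_measurable_EFin => //; rewrite /E; continuity.
have f_f : {ae mu, forall w, setT w -> f_ ^~ w @ \oo --> f w}.
  apply: aeW => w _; rewrite /f; under eq_fun do rewrite f_E.
  apply: cvg_EFin; first exact: nearW.
  apply: cvgM; first exact: cvg_cst.
  exact: (is_cvg_pseries (exp_type_bessel_coeff hnu)).
have ig : mu.-integrable setT g.
  apply/integrableP; split.
    by apply: ge0_emeasurable_sum => // k _; exact: maF.
  under eq_integral => w _.
    rewrite gee0_abs; last by apply: nneseries_ge0.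
    over.
  rewrite integral_nneseries//.
  under eq_eseriesr do rewrite iaF.
  apply: nneseries_EFin_lty => [k|].
    by rewrite mulr_ge0 ?expR_ge0// exp_coeff_ge0// mulr_ge0 ?expR_ge0.
  exact: (is_cvg_seriesZ (is_cvg_series_exp_coeff _)).
have f_g : {ae mu, forall w n, setT w -> (`|f_ n w| <= g w)%E}.
  apply: aeW => w n _; apply: (@le_trans _ _ (\sum_(0 <= k < n) `|F k w|%:E)%E).
    exact: lee_abs_sum.
  by apply: nneseries_lim_ge => k _ _.
have [_ _] := @dominated_convergence _ _ _ mu setT measurableT f_ f g mf_ mf f_f ig f_g.
move/cvg_lim => <-//.
have -> : (fun n => \int[mu]_w f_ n w)%E = EFin \o (fun n => e0 * series (exp_coeff (- (X * expR (- u)))) n).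
  apply/funext => n; rewrite integral_sum//.
  under eq_bigr do rewrite iF.
  by rewrite sumEFin/= /series/= mulr_sumr.
have h : e0 * series (exp_coeff (- (X * expR (- u)))) n @[n --> \oo] -->
    e0 * expR (- (X * expR (- u))).
  by apply: cvgM; [exact: cvg_cst|exact: is_cvg_series_exp_coeff].
by rewrite EFin_lim; [rewrite (cvg_lim _ h)|apply/cvg_ex; eexists; exact: h].
Qed.

End weber_integral.

(** * Gegenbauer's formula *)

Section gegenbauer_bound.
Context {R : realType}.
Notation mu := (@lebesgue_measure R).

(** In the variables s = e^u and t^2 = e^w, multiplying s by 1 + t^2 is the translation of u by
    [softplus w]. *)
Definition softplus (w : R) : R := ln (1 + expR w).

Lemma expR_addsoftplus (u w : R) : expR (u + softplus w) = expR u + expR (w + u).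
Proof.
by rewrite expRD lnK ?posrE ?addr_gt0 ?expR_gt0// mulrDr mulr1 -expRD addrC [u + w]addrC addrC.
Qed.

Lemma continuous_softplus : continuous softplus.
Proof.
move=> w; apply: (@continuous_comp _ _ _ (fun w : R => 1 + expR w) (@ln R)).
  have : continuous (fun w : R => 1 + expR w) by continuity.
  exact.
by apply: continuous_ln; rewrite addr_gt0 ?expR_gt0.
Qed.

(* Integrating out w first and then u gives Gamma a * Gamma (c - a); in the other
   order it gives Gamma c times a beta integral. The same kernel dominates the
   integrand of Gegenbauer's formula. *)
Definition beta_kernel (a c : R) (z : R * R) : R :=
  expR (c * z.1 - expR z.1) * expR (a * z.2 - expR (z.2 + z.1)).

Lemma measurable_beta_kernel (a c : R) : measurable_fun setT (beta_kernel a c).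
Proof.
have m1 : measurable_fun setT (fun z : R * R => z.1) by exact: measurable_fst.
have m2 : measurable_fun setT (fun z : R * R => z.2) by exact: measurable_snd.
have mE (h : R * R -> R) : measurable_fun setT h -> measurable_fun setT (fun z => expR (h z)).
  by move=> mh; apply: measurableT_comp => //; exact: measurable_expR.
rewrite /beta_kernel; apply: measurable_funM; apply: (mE _); apply: measurable_funB.
- by apply: measurable_funM => //; exact: measurable_cst.
- exact: (mE _).
- by apply: measurable_funM => //; exact: measurable_cst.
- by apply: (mE _); exact: measurable_funD.
Qed.

Lemma beta_kernel_ge0 (a c : R) z : 0 <= beta_kernel a c z.
Proof. by rewrite mulr_ge0 ?expR_ge0. Qed.

Lemma integral_beta_kernel (a c : R) : 0 < a -> a < c ->
  (\int[mu]_u \int[mu]_w (beta_kernel a c (u, w))%:E = (Gamma a * Gamma (c - a))%:E)%E.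
Proof.
move=> a0 ac; have ca0 : 0 < c - a by rewrite subr_gt0.
rewrite EFinM -(integral_gammaker ca0) -ge0_integralZl_EFin//; first last.
- by rewrite ltW ?Gamma_gt0.
- exact: continuous_measurable_EFin (@continuous_gammaker _ _).
- by move=> u _; rewrite lee_fin ltW ?gammaker_gt0.
apply: eq_integral => u _; rewrite /beta_kernel/=.
under eq_integral do rewrite EFinM.
rewrite ge0_integralZl_EFin ?expR_ge0//; last first.
  by apply: continuous_measurable_EFin => //; continuity.
rewrite integral_gammaker_scale// /gammaker -!EFinM mulrA -expRD mulrC.
by congr (_ * expR _)%:E; ring.
Qed.

Lemma integrable_beta_kernel (a c : R) : 0 < a -> a < c ->
  (mu \x mu)%E.-integrable setT (EFin \o beta_kernel a c).
Proof.
move=> a0 ac; apply/integrable12ltyP.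
  by apply/measurable_EFinP; exact: measurable_beta_kernel.
under eq_integral => u _.
  under eq_integral do rewrite /= ger0_norm ?beta_kernel_ge0//.
  over.
by rewrite integral_beta_kernel// ltry.
Qed.

(** With p = e^w this is the beta integral of p^(a-1) (1 + p)^-c. Integrating [beta_kernel] first in
    u gives Gamma(c) times its integrand, and Tonelli's theorem exchanges the orders. *)
Lemma integral_softplus (a c : R) : 0 < a -> a < c ->
  (\int[mu]_w (expR (a * w - c * softplus w))%:E =
   (Gamma a * Gamma (c - a) / Gamma c)%:E)%E.
Proof.
move=> a0 ac; have c0 : 0 < c by rewrite (lt_trans a0).
have Gc := Gamma_gt0 c0.
rewrite -[LHS]mule1 -(mulVf (lt0r_neq0 Gc)) EFinM muleCA.
rewrite [RHS](_ : _ = ((Gamma c)^-1)%:E * (Gamma a * Gamma (c - a))%:E)%E; last first.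
  by rewrite -EFinM mulrC.
congr (_ * _)%E; rewrite -integral_beta_kernel//.
transitivity (\int[mu]_w \int[mu]_u (beta_kernel a c (u, w))%:E)%E; last first.
  apply/esym/(@fubini_tonelli _ _ _ _ _ mu mu (EFin \o beta_kernel a c)).
    by apply/measurable_EFinP; exact: measurable_beta_kernel.
  by move=> z; rewrite lee_fin beta_kernel_ge0.
rewrite muleC -ge0_integralZl_EFin//; first last.
- exact: ltW.
- apply: continuous_measurable_EFin => //; have := continuous_softplus; move=> cs; continuity.
apply: eq_integral => w _; rewrite /beta_kernel/=.
under [RHS]eq_integral => u _.
  rewrite (_ : _ * _ = expR (a * w) * expR (c * u - expR (u + softplus w))); last first.
    by rewrite -!expRD expR_addsoftplus; congr expR; ring.
  rewrite EFinM; over.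
rewrite ge0_integralZl_EFin ?expR_ge0//; last first.
  by apply: continuous_measurable_EFin => //; continuity.
rewrite integral_gammaker_scale// -!EFinM mulrCA mulrA -expRD mulrC.
by congr (expR _ * _)%:E; ring.
Qed.

(** This is sqrt t |J_nu(t)| <= c_nu at t = x e^(w/2), for which t^2/4 is the argument on the left,
    solved for the entire factor. *)
Lemma bessel_entire_bound (nu x w : R) : - (1 / 2) <= nu -> 0 < x ->
  `|bessel_entire nu (x ^+ 2 / 4 * expR w)| <=
  2 `^ nu * bessel_sup nu * x `^ (- nu - 1 / 2) * expR (- ((nu / 2 + 1 / 4) * w)).
Proof.
move=> hnu x0; pose t := x * expR (w / 2).
have t0 : 0 < t by rewrite mulr_gt0 ?expR_gt0.
have tE : t ^+ 2 / 4 = x ^+ 2 / 4 * expR w.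
  rewrite /t exprMn -expRM_natl mulrAC; congr (_ * expR _); by field.
have := bessel_sup_ge hnu (ltW t0); rewrite sqrt_besselJE// tE.
have -> : t `^ (nu + 1 / 2) = x `^ (nu + 1 / 2) * expR ((nu / 2 + 1 / 4) * w).
  rewrite powRM ?expR_ge0 ?(ltW x0)//; congr (_ * _).
  rewrite /powR gt_eqF ?expR_gt0// expRK; congr expR; by field.
set B := `|_|; set S := bessel_sup nu => h.
have -> : - nu - 1 / 2 = - (nu + 1 / 2) by ring.
rewrite powRN expRN.
have p2 : 0 < (2 : R) `^ nu by rewrite powR_gt0.
have px : 0 < x `^ (nu + 1 / 2) by rewrite powR_gt0.
have ew := expR_gt0 ((nu / 2 + 1 / 4) * w).
rewrite ler_pdivlMr// ler_pdivlMr// mulrC.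
move: h; rewrite powRN ler_pdivrMl// => h.
by apply: le_trans h; rewrite mulrCA mulrC.
Qed.

(* With X = x^2 / 4, the factor exp (- X e^-u) is replaced by Weber's integral
   and the order of integration exchanged; the inner integral in u is then a
   rotated component of Gamma (nu - m + 1 + i tau), scaled by 1 + e^w. *)
Lemma macdonald_integral_bound (nu m x tau phi : R) :
  - (1 / 2) <= nu -> m < 1 / 2 * (nu + 1 / 2) -> 0 < x ->
  `|\int[mu]_u (expR (- m * u - expR u - x ^+ 2 / 4 * expR (- u)) * cos (phi + tau * u))|
  <= 2 `^ nu * bessel_sup nu * x `^ (- nu - 1 / 2) *
     (Gamma ((nu + 3 / 2) / 2) * Gamma ((nu - 2 * m + 1 / 2) / 2) / Gamma (nu - m + 1)) *
     complex_norm (cGamma ((nu - m + 1) +i* tau)).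
Proof.
move=> hnu hm x0.
set a := (nu + 3 / 2) / 2; set c := nu - m + 1; set X := x ^+ 2 / 4.
set K := 2 `^ nu * bessel_sup nu * x `^ (- nu - 1 / 2).
set G := complex_norm _.
(* The exponent [a] is nu + 1 minus the decay rate nu/2 + 1/4 of [bessel_entire_bound]. The
   hypothesis [hm] says exactly that a < c, so that the beta integral converges. *)
have -> : (nu - 2 * m + 1 / 2) / 2 = c - a by rewrite /c /a; field.
have a0 : 0 < a by rewrite /a; lra.
have ac : a < c by rewrite /a /c; lra.
have c0 : 0 < c by rewrite (lt_trans a0).
have X0 : 0 <= X by rewrite /X divr_ge0// exprn_ge0// ltW.
have cb := continuous_bessel_entire hnu.
have cs := continuous_softplus.
pose A u := expR (c * u - expR u) * cos (phi + tau * u).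
pose B w := bessel_entire nu (X * expR w).
have cB : continuous B by rewrite /B; continuity.
have hB w : `|B w| <= K * expR (- ((nu / 2 + 1 / 4) * w)) by exact: bessel_entire_bound.
(* The sign of [K], and with it that of c_nu, is read off the bound at w = 0. *)
have K0 : 0 <= K by have := le_trans (normr_ge0 _) (hB 0); rewrite mulr0 oppr0 expR0 mulr1.
pose f (z : R * R) := A z.1 * (expR ((nu + 1) * z.2 - expR (z.2 + z.1)) * B z.2).
have mf : measurable_fun setT (EFin \o f).
  have m1 : measurable_fun setT (fun z : R * R => z.1) by exact: measurable_fst.
  have m2 : measurable_fun setT (fun z : R * R => z.2) by exact: measurable_snd.
  apply/measurable_EFinP; apply: measurable_funM.
    apply: (measurableT_comp (f := A)) => //; apply: continuous_measurable_fun.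
    by rewrite /A; continuity.
  apply: measurable_funM.
    apply: measurableT_comp; first exact: measurable_expR.
    apply: measurable_funB; first by apply: measurable_funM => //; exact: measurable_cst.
    by apply: measurableT_comp; [exact: measurable_expR|exact: measurable_funD].
  by apply: (measurableT_comp (f := B)) => //; apply: continuous_measurable_fun.
have hEB w u : expR ((nu + 1) * w - expR (w + u)) * `|B w| <= K * expR (a * w - expR (w + u)).
  have -> : expR (a * w - expR (w + u)) =
      expR ((nu + 1) * w - expR (w + u)) * expR (- ((nu / 2 + 1 / 4) * w)).
    by rewrite -expRD; congr expR; rewrite /a; field.
  by rewrite mulrCA; apply: ler_wpM2l; [exact: expR_ge0|exact: hB].
have hf u w : `|f (u, w)| <= K * beta_kernel a c (u, w).
  rewrite /f /A /beta_kernel/= !normrM.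
  rewrite [`|expR (c * u - _)|]ger0_norm ?expR_ge0// [`|expR (_ * w - _)|]ger0_norm ?expR_ge0//.
  rewrite [leRHS]mulrCA -mulrA; apply: ler_wpM2l; first exact: expR_ge0.
  rewrite -[leRHS]mul1r; apply: ler_pM.
  - exact: normr_ge0.
  - by rewrite mulr_ge0 ?expR_ge0.
  - exact: cos_max.
  - exact: hEB.
have intf : (mu \x mu)%E.-integrable setT (EFin \o f).
  apply: (@le_integrable _ _ _ (mu \x mu)%E _ measurableT _ (fun z => (K%:E * (beta_kernel a c z)%:E)%E)) => //.
  - move=> [u w] _; rewrite [leRHS]/= lee_fin; apply: le_trans (hf u w) _.
    exact: ler_norm.
  - by apply: integrableZl => //; exact: integrable_beta_kernel.
(* Weber's integral in w also yields e^(-(nu + 1) u), which lowers the exponent c of [A] to -m. *)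
have -> : \int[mu]_u (expR (- m * u - expR u - X * expR (- u)) * cos (phi + tau * u)) =
    fine (\int[mu]_w \int[mu]_u (f (u, w))%:E)%E.
  have <- := @Fubini _ _ _ _ _ mu mu _ intf.
  congr fine; apply: eq_integral => u _; rewrite /f/=.
  under [RHS]eq_integral do rewrite EFinM.
  rewrite integralZl//=; last first.
    apply: (@le_integrable _ _ _ mu _ measurableT _ (fun w => (K%:E * (expR (a * w - expR (w + u)))%:E)%E)) => //.
    - by apply: continuous_measurable_EFin => //; continuity.
    - move=> w _; rewrite [leRHS]/= lee_fin normrM ger0_norm ?expR_ge0//.
      by apply: le_trans (hEB w u) _; exact: ler_norm.
    - by apply: integrableZl => //; exact: integrable_gammaker_scale.
  rewrite weber_integral// -EFinM /A; congr EFin.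
  by rewrite [RHS]mulrAC -!expRD; congr (expR _ * _); rewrite /c; ring.
(* The exponentials e^u and e^(w + u) merge into e^(u + softplus w), so the u-integral is bounded by
   (1 + e^w)^-c |Gamma(c + i tau)|. *)
have inner w : (`|\int[mu]_u (f (u, w))%:E| <= (K * G * expR (a * w - c * softplus w))%:E)%E.
  have ig := integrable_gammaker_cos tau phi (softplus w) c0.
  have fE u : f (u, w) = expR ((nu + 1) * w) * B w *
      (expR (c * u - expR (u + softplus w)) * cos (phi + tau * u)).
    rewrite /f /A/= expR_addsoftplus.
    by rewrite mulrACA [RHS]mulrACA -!expRD [B w * _]mulrC; congr (expR _ * _); ring.
  under eq_integral do rewrite fE EFinM.
  rewrite integralZl// -[X in (_ * X)%E]fineK; last exact: integrable_fin_num.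
  rewrite -EFinM lee_fin normrM normrM ger0_norm ?expR_ge0//.
  have := integral_gammaker_cos_bound tau phi (softplus w) c0; rewrite -/G => hG.
  have hBw : expR ((nu + 1) * w) * `|B w| <= K * expR (a * w).
    have -> : expR (a * w) = expR ((nu + 1) * w) * expR (- ((nu / 2 + 1 / 4) * w)).
      by rewrite -expRD; congr expR; rewrite /a; field.
    by rewrite mulrCA; apply: ler_wpM2l; [exact: expR_ge0|exact: hB].
  have -> : K * G * expR (a * w - c * softplus w) =
      K * expR (a * w) * (expR (- (c * softplus w)) * G) by rewrite expRD; ring.
  apply: ler_pM => //; exact: mulr_ge0 (expR_ge0 _) (normr_ge0 _).
have G0 : 0 <= G by rewrite sqrtr_ge0.
have bound : (`|\int[mu]_w \int[mu]_u (f (u, w))%:E| <=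
    (K * (Gamma a * Gamma (c - a) / Gamma c) * G)%:E)%E.
  have mG : measurable_fun setT (fun w => \int[mu]_u (f (u, w))%:E)%E.
    exact: (measurable_fubini_G intf).
  have := @le_abse_integral _ _ _ mu _ _ measurableT mG => /le_trans; apply.
  rewrite (_ : K * _ * G = (K * G) * (Gamma a * Gamma (c - a) / Gamma c)); last by ring.
  rewrite EFinM -integral_softplus// -ge0_integralZl_EFin//; first last.
  - exact: mulr_ge0.
  - by apply: continuous_measurable_EFin => //; continuity.
  apply: ge0_le_integral => //.
  - exact: measurableT_comp.
  - by apply: emeasurable_funM; [exact: measurable_cst|apply: continuous_measurable_EFin => //; continuity].
have If : (\int[mu]_w \int[mu]_u (f (u, w))%:E)%E \is a fin_num.
  by rewrite fin_num_abs (le_lt_trans bound)// ltry.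
by rewrite -lee_fin -fine_abse// fineK// abse_fin_num.
Qed.

End gegenbauer_bound.

(** * The Macdonald function *)

Section macdonald.
Context {R : realType}.
Notation mu := (@lebesgue_measure R).

(** The component in the direction phi = arg z is the modulus itself. *)
Lemma complex_norm_le_angle (z : R[i]) (M : R) :
  (forall phi, cos phi * complex.Re z + sin phi * complex.Im z <= M) ->
  complex_norm z <= M.
Proof.
case: z => A B /= h; set N := Num.sqrt (A ^+ 2 + B ^+ 2).
have S0 : 0 <= A ^+ 2 + B ^+ 2 by rewrite addr_ge0 ?sqr_ge0.
have N2 : N ^+ 2 = A ^+ 2 + B ^+ 2 by rewrite sqr_sqrtr.
have N0 : 0 <= N by exact: sqrtr_ge0.
move: N0; rewrite le_eqVlt => /predU1P[NE|N0].
  have A0 : A = 0.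
    apply/eqP; rewrite -sqrf_eq0; move: (sqr_ge0 A) (sqr_ge0 B) N2.
    rewrite -NE expr0n/= => a0 b0 ab; rewrite eq_le a0 andbT; lra.
  have B0 : B = 0.
    apply/eqP; rewrite -sqrf_eq0; move: (sqr_ge0 A) (sqr_ge0 B) N2.
    rewrite -NE expr0n/= => a0 b0 ab; rewrite eq_le b0 andbT; lra.
  by have := h 0; rewrite A0 B0 !mulr0 addr0 -NE.
have AN : -1 <= A / N <= 1.
  rewrite -ler_norml normrM [`|N^-1|]ger0_norm ?invr_ge0 ?(ltW N0)// ler_pdivrMr// mul1r.
  by rewrite -sqrtr_sqr ler_wsqrtr// lerDl sqr_ge0.
have c : cos (acos (A / N)) = A / N by apply: acosK; rewrite in_itv.
have s : sin (acos (A / N)) = `|B| / N.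
  rewrite sin_acos// [X in Num.sqrt X](_ : _ = (`|B| / N) ^+ 2).
    by rewrite sqrtr_sqr ger0_norm// divr_ge0// ltW.
  rewrite !exprMn real_normK ?num_real// !exprVn N2; field.
  by rewrite -N2 sqrf_eq0 gt_eqF.
(* [acos] only returns angles of the closed upper half plane, so the sign of [B] selects the half
   plane. *)
pose phi := if 0 <= B then acos (A / N) else - acos (A / N).
have := h phi; suff -> : cos phi * A + sin phi * B = N by [].
have NN : N * N = A * A + B * B by rewrite -!expr2.
rewrite /phi; case: ifPn => [B0|]; last rewrite -ltNge => B0; rewrite ?cosN ?sinN c s.
- rewrite ger0_norm// mulrAC [_ / N * B]mulrAC -mulrDl -NN mulfK ?gt_eqF//.
- rewrite ltr0_norm// !mulNr opprK mulrAC [_ / N * B]mulrAC -mulrDl -NN mulfK ?gt_eqF//.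
Qed.

Lemma ccosh_real_mul (m tau t : R) :
  ccosh ((m +i* tau) * t%:C) =
  ((expR (m * t) + expR (- (m * t))) * cos (tau * t) / 2) +i*
  ((expR (m * t) - expR (- (m * t))) * sin (tau * t) / 2).
Proof.
rewrite /ccosh /cexp; have -> : (2 : R[i])^-1 = (2^-1 : R)%:C.
  by rewrite fmorphV rmorph_nat.
rewrite /= !(mulr0, subr0, addr0, add0r) cosN sinN.
by apply/eqP; rewrite eq_complex/= !(mulr0, subr0, addr0, add0r); apply/andP; split; apply/eqP; ring.
Qed.
Lemma cosh_ge (t : R) : expR `|t| / 2 <= cosh t.
Proof.
rewrite /cosh ler_pM2r ?invr_gt0//.
have [t0|t0] := leP 0 t; first by rewrite ger0_norm// lerDl expR_ge0.
by rewrite ltr0_norm// lerDr expR_ge0.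
Qed.

Lemma continuous_cosh : continuous (@cosh R).
Proof. by rewrite /cosh; continuity. Qed.

Lemma integrable_macdonald (f : R -> R) (x k : R) : 0 < x -> continuous f ->
  (forall t, `|f t| <= expR (- x * cosh t + k * `|t|)) ->
  mu.-integrable setT (EFin \o f).
Proof.
(* Since x cosh t >= (x/2) e^|t|, the double exponential absorbs the slope |k| + 1; the extra 1
   leaves the dominating factor e^-|t|. *)
move=> x0 cf hf; have k0 : 0 < `|k| + 1 by rewrite ltr_wpDl.
have x20 : 0 < x / 2 by rewrite divr_gt0.
have [C hC] := linear_sub_expR_bounded k0 x20.
apply: (@integrable_expR_dominated _ _ 1 (expR C) ltr01 cf) => t.
apply: le_trans (hf t) _; rewrite -expRD ler_expR mul1r.
have := hC `|t|; have := ler_wpM2l (ltW x0) (cosh_ge t).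
have := ler_wpM2r (normr_ge0 t) (ler_norm k); lra.
Qed.

Lemma expR_le_norm (m t : R) :
  expR (m * t) <= expR (`|m| * `|t|) /\ expR (- (m * t)) <= expR (`|m| * `|t|).
Proof. by rewrite !ler_expR -normrM ler_norm -normrN ler_norm. Qed.

Lemma integrable_macdonald_angle (m tau x phi : R) : 0 < x ->
  mu.-integrable setT (EFin \o (fun u => expR (- x * cosh u - m * u) * cos (phi + tau * u))).
Proof.
move=> x0; have cc := continuous_cosh.
apply: (@integrable_macdonald _ _ `|m| x0); first by continuity.
move=> t; rewrite normrM ger0_norm ?expR_ge0//.
apply: le_trans (ler_piMr (expR_ge0 _) (cos_max _)) _.
by rewrite expRD [leRHS]expRD ler_wpM2l ?expR_ge0//; case: (expR_le_norm m t).
Qed.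

(** By evenness of cosh, K_z(x) is half the integral of e^(-x cosh u - z u) over the line; this is
    the real part after multiplication by e^(-i phi). *)
Lemma macdonaldK_angle (m tau x phi : R) : 0 < x ->
  cos phi * complex.Re (macdonaldK (m +i* tau) x) +
  sin phi * complex.Im (macdonaldK (m +i* tau) x) =
  2^-1 * \int[mu]_u (expR (- x * cosh u - m * u) * cos (phi + tau * u)).
Proof.
move=> x0; have cc := continuous_cosh.
(* The explicit signs 1 and -1 give [P] and [Q] a common shape, so that [ia] proves both
   integrable. *)
pose P t := expR (- x * cosh t) * ((expR (m * t) + 1 * expR (- (m * t))) * cos (tau * t) / 2).
pose Q t := expR (- x * cosh t) * ((expR (m * t) + (- 1) * expR (- (m * t))) * sin (tau * t) / 2).
have kE : macdonaldK (m +i* tau) x =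
    (\int[mu]_(t in `[0, +oo[) P t) +i* (\int[mu]_(t in `[0, +oo[) Q t).
  rewrite /macdonaldK /cintegral; congr (_ +i* _); apply: eq_Rintegral => t _.
    by rewrite ccosh_real_mul/= mul0r subr0 /P mul1r.
  by rewrite ccosh_real_mul/= mul0r addr0 /Q mulN1r.
have ia (s : R) (trig : R -> R) : continuous trig -> (forall t, `|trig t| <= 1) -> `|s| = 1 ->
   mu.-integrable `[0%R, +oo[ (EFin \o (fun t => expR (- x * cosh t) * ((expR (m * t) + s * expR (- (m * t))) * trig (tau * t) / 2))).
  move=> ct t1 s1; apply: (@integrableS _ _ _ mu setT) => //.
  apply: (@integrable_macdonald _ _ `|m| x0); first by continuity.
  move=> t; rewrite expRD !normrM ger0_norm ?expR_ge0//; apply: ler_wpM2l; first exact: expR_ge0.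
  have [e1 e2] := expR_le_norm m t.
  have hs : `|expR (m * t) + s * expR (- (m * t))| <= 2 * expR (`|m| * `|t|).
    apply: le_trans (ler_normD _ _) _; rewrite normrM s1 mul1r.
    by rewrite 2?[`|expR _|]ger0_norm ?expR_ge0//; lra.
  rewrite [`|2^-1|]ger0_norm// ler_pdivrMr// mulrC [leRHS]mulrC -[leRHS]mul1r.
  by apply: ler_pM.
have iP : mu.-integrable `[0%R, +oo[ (EFin \o P).
  exact: ia (@continuous_cos R) (@cos_max R) (normr1 _).
have iQ : mu.-integrable `[0%R, +oo[ (EFin \o Q).
  exact: ia (@continuous_sin R) (@sin_max R) (normrN1 _).
rewrite kE/= -!RintegralZl//; last exact: integrable_macdonald_angle.
rewrite -RintegralD//; [|exact: integrableZl iP|exact: integrableZl iQ].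
pose f u := expR (- x * cosh u - m * u) * cos (phi + tau * u).
have cf : continuous f by rewrite /f; continuity.
have iff : mu.-integrable setT (EFin \o f) by exact: integrable_macdonald_angle.
rewrite /Rintegral -(@integral_even_part _ (fun u => 2^-1 * f u)); first last.
- exact: integrableZl iff.
- by continuity.
congr fine; apply: eq_integral => t _; congr EFin.
have cN : cosh (- t) = cosh t by rewrite /cosh opprK addrC.
rewrite /P /Q /f cN !mulrN opprK !cosD cosN sinN.
rewrite [expR (- x * _ - m * t)]expRD [expR (- x * _ + m * t)]expRD; ring.
Qed.

(** Translating u by ln (2/x) turns x cosh u into e^u + (x^2/4) e^-u. With s = e^u the result is the
    classical integral of s^(-z-1) e^(-s - x^2/(4 s)), and the phase moves by tau ln (2/x). *)
Lemma macdonald_integral_shift (m tau x phi : R) : 0 < x ->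
  \int[mu]_u (expR (- x * cosh u - m * u) * cos (phi + tau * u)) =
  (x / 2) `^ m * \int[mu]_u (expR (- m * u - expR u - x ^+ 2 / 4 * expR (- u)) *
                           cos (phi + tau * ln (2 / x) + tau * u)).
Proof.
move=> x0; have cc := continuous_cosh.
have x20 : 0 < 2 / x by rewrite divr_gt0.
set l := ln (2 / x).
have el : expR l = 2 / x by rewrite lnK.
have eNl : expR (- l) = x / 2 by rewrite expRN el invf_div.
have xm : (x / 2) `^ m = expR (- m * l).
  by rewrite /powR gt_eqF ?divr_gt0// -eNl expRK; congr expR; ring.
pose f u := expR (- x * cosh u - m * u) * cos (phi + tau * u).
have cf : continuous f by rewrite /f; continuity.
set g := (X in _ = _ * Rintegral _ _ X).
have gE u : f (u + l) = expR (- m * l) * g u.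
  rewrite /f /g mulrA -expRD; congr (expR _ * cos _); last by ring.
  by rewrite /cosh opprD !expRD el eNl; field; rewrite gt_eqF.
have iff : mu.-integrable setT (EFin \o f) by exact: integrable_macdonald_angle.
have ig : mu.-integrable setT (EFin \o g).
  apply: (@eq_integrable _ _ _ mu _ measurableT (fun u => ((expR (m * l))%:E * (f (u + l))%:E)%E)).
    move=> u _; rewrite -EFinM gE mulrA -expRD.
    by rewrite (_ : m * l + - m * l = 0) ?expR0 ?mul1r//; ring.
  have cfl : continuous (fun u => f (u + l)) by continuity.
  apply: integrableZl => //; apply/integrableP; split.
    exact: continuous_measurable_EFin.
  rewrite /= (@integral_shift _ (fun u => `|f u|) l); last by continuity.
  by case/integrableP: iff.
rewrite xm -RintegralZl// /Rintegral -(@integral_shift _ f l)//; congr fine.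
by apply: eq_integral => u _; rewrite gE.
Qed.

End macdonald.

Theorem mainTheorem5 (R : realType) (nu mu : R)
    (hnu : - (1 / 2) <= nu) (hmu : mu < 1 / 2 * (nu + 1 / 2))
    (x tau : R) (hx : 0 < x) (htau : 0 < tau) :
  complex_norm (macdonaldK (mu +i* tau) x) <=
    2 `^ (nu - mu - 1) * bessel_sup nu *
    (Gamma ((nu + 3 / 2) / 2) * Gamma ((nu - 2 * mu + 1 / 2) / 2)
       / Gamma (nu - mu + 1)) *
    complex_norm (cGamma ((nu - mu + 1) +i* tau)) *
    x `^ (mu - nu - 1 / 2).
Proof.
apply: complex_norm_le_angle => phi.
rewrite macdonaldK_angle// macdonald_integral_shift//.
have := macdonald_integral_bound tau (phi + tau * ln (2 / x)) hnu hmu hx.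
set I := Rintegral _ _ _; set G := _ / Gamma _; set N := complex_norm _ => hI.
(* The factor 1/2 comes from unfolding to the whole line, 2^nu from the Bessel bound and 2^-mu from
   (x/2)^mu. *)
have -> : 2 `^ (nu - mu - 1) = 2^-1 * (2 `^ nu * (2 `^ mu)^-1) :> R.
  rewrite -powRN -powRD; last by rewrite pnatr_eq0 implybT.
  rewrite powRD; last by rewrite pnatr_eq0 implybT.
  by rewrite powR_inv1// mulrC.
have -> : x `^ (mu - nu - 1 / 2) = x `^ mu * x `^ (- nu - 1 / 2).
  rewrite -powRD; last by rewrite [x == 0]gt_eqF ?implybT.
  by congr (_ `^ _); ring.
have -> : (x / 2) `^ mu = x `^ mu * (2 `^ mu)^-1.
  by rewrite powRM ?(ltW hx)// -[2^-1]powR_inv1// -powRrM mulN1r powRN.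
apply: le_trans (_ : 2^-1 * (x `^ mu * (2 `^ mu)^-1 * `|I|) <= _).
  by rewrite !ler_wpM2l ?mulr_ge0 ?invr_ge0 ?powR_ge0// ler_norm.
rewrite [leRHS](_ : _ = 2^-1 * (x `^ mu * (2 `^ mu)^-1 *
  (2 `^ nu * bessel_sup nu * x `^ (- nu - 1 / 2) * G * N))); last by ring.
by rewrite !ler_wpM2l ?mulr_ge0 ?invr_ge0 ?powR_ge0.
Qed.
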